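(* Consider the $q$-difference equation $L_1y(z)=0$ associated with the $q$-Painlevé equation of type $E_8^{(1)}$, i.e. $$\frac{q^5U(z/q)}{(z^2-h_1q^2)(f-f(z/q))}\Bigl[y(z/q)-\frac{g-g(qh_1/z)}{g-g(z/q)}y(z)\Bigr]+\frac{z^8U(h_1/z)}{h_1^4(z^2-h_1)(f-f(z))}\Bigl[y(qz)-\frac{g-g(z)}{g-g(h_1/z)}y(z)\Bigr]+\frac{(h_1-h_2)z^2(z^2-qh_1)V(\overline f(z/q),f;g)}{qh_1^3h_2^3\,g\,\varphi(f,g)\{g-g(h_1/z)\}\{g-g(z/q)\}}y(z)=0,$$ with all notation as in the context. Set $$y(z)=\frac{(z-qu_1)(u_1z-h_1)}{z}\,\tilde y(z)$$ and put $$f=u_1+\varepsilon c_1+\frac{h_1}{u_1+\varepsilon c_1},\qquad g=u_1+\varepsilon c_2+\frac{h_2}{u_1+\varepsilon c_2},$$ with $c_1\neq c_2$. Then, as $\varepsilon\to0$, the equation tends to $$B^-(z)\tilde y(z/q)+B^+(z)\tilde y(qz)+B^0(z)\tilde y(z)=\Bigl(C_0\frac{c_2}{c_1-c_2}+C_0'\Bigr)\tilde y(z),$$ where $$B^-(z)=\frac{z-q^2u_1}{q^2h_1z^2(z^2-qh_1)(z^2-q^2h_1)}\prod_{j=2}^8(z-qu_j),\qquad B^+(z)=\frac{q(qu_1z-h_1)}{h_1^5z^2(z^2-qh_1)(z^2-h_1)}\prod_{j=2}^8(u_jz-h_1),$$ $$B^0(z)=\frac{-qz(h_1^{1/2}-qu_1)}{2h_1^{7/2}(z-h_1^{1/2})(z-qh_1^{1/2})}\prod_{j=2}^8(h_1^{1/2}-u_j)+\frac{qz(h_1^{1/2}+qu_1)}{2h_1^{7/2}(z+h_1^{1/2})(z+qh_1^{1/2})}\prod_{j=2}^8(h_1^{1/2}+u_j)$$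 $$-\frac{q^{3/2}}{h_1}(u_1u_2\cdots u_8)^{1/2}\Bigl[(q+1)\Bigl(\frac{z^2}{(qh_1)^2}+\frac1{z^2}\Bigr)-\Bigl(\frac{z}{qh_1}+\frac1z\Bigr)\Bigl\{q\frac{u_1}{h_1}+\frac1{qu_1}+\sum_{j=2}^8\Bigl(\frac{u_j}{h_1}+\frac1{u_j}\Bigr)\Bigr\}\Bigr],$$ $$C_0=\frac{q(h_2-h_1)}{h_1^2u_1(h_1-u_1^2)(h_2-u_1^2)}\prod_{j=2}^8(u_1-u_j),$$ and $C_0'$ is a constant which does not depend on $z$, $c_1$ and $c_2$.
   Context: $q,u_1,\dots,u_8,h_1,h_2$ are non-zero complex parameters with $h_1^2h_2^2=q\,u_1u_2\cdots u_8$, and generic in the sense that $h_1\ne h_2$, $u_1^2\neq h_1$, $u_1^2\ne\pm h_2$. The square roots are chosen so that $q^{1/2}(u_1\cdots u_8)^{1/2}=h_1h_2$; $h_1^{1/2}$ is any fixed square root of $h_1$ and $h_1^{7/2}=(h_1^{1/2})^7$. Set $U(z)=\prod_{i=1}^8(z-u_i)$. The quartic polynomials $P_n,P_d$ are defined by $$\Bigl(z-\frac{h_2}z\Bigr)P_n\Bigl(z+\frac{h_2}z\Bigr)=\frac{U(z)}{z^3}-\Bigl(\frac z{h_2}\Bigr)^3U\Bigl(\frac{h_2}z\Bigr),\qquad \Bigl(z-\frac{h_2}z\Bigr)P_d\Bigl(z+\frac{h_2}z\Bigr)=z^5U\Bigl(\frac{h_2}z\Bigr)-\Bigl(\frac{h_2}z\Bigr)^5U(z).$$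 Further, $$\psi_n(f_1,f_2;g)=(f_1-g)(f_2-g)-\Bigl(\frac{h_1}q-h_2\Bigr)(h_1-h_2)\frac1{h_2},$$ $$\psi_d(f_1,f_2;g)=\Bigl(\frac{f_1}{h_1}q-\frac g{h_2}\Bigr)\Bigl(\frac{f_2}{h_1}-\frac g{h_2}\Bigr)-\Bigl(\frac q{h_1}-\frac1{h_2}\Bigr)\Bigl(\frac1{h_1}-\frac1{h_2}\Bigr)h_2,$$ $$V(f_1,f_2;g)=q\,\psi_n(f_1,f_2;g)P_d(g)-h_1^2h_2^4\,\psi_d(f_1,f_2;g)P_n(g),$$ $$\varphi(f,g)=(f-g)\Bigl(\frac f{h_1}-\frac g{h_2}\Bigr)-(h_1-h_2)\Bigl(\frac1{h_1}-\frac1{h_2}\Bigr).$$ Notation: $f$ and $g$ standing alone are parameters (the Painlevé variables), whereas with an argument they denote the functions $f(u)=u+h_1/u$, $g(u)=u+h_2/u$; also $\overline f(u)=u+h_1/(qu)$. ''The equation tends to ... as $\varepsilon\to0$'' means: after the substitutions and after multiplying the equation by a common nonzero rational function of $z$ independent of $\varepsilon$, the coefficients of $\tilde y(z/q)$, $\tilde y(qz)$, $\tilde y(z)$ converge, as $\varepsilon\to0$, to those of the limit equation (with all terms moved to one side). *)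

(* Defs.v *)
From HB Require Import structures.
From mathcomp Require Import all_boot all_order all_algebra.
From mathcomp Require Import complex.
From mathcomp Require Import all_classical all_reals all_analysis.

Set Implicit Arguments.
Unset Strict Implicit.
Unset Printing Implicit Defensive.

Import Order.TTheory GRing.Theory Num.Theory.
Import numFieldNormedType.Exports.

Local Open Scope classical_set_scope.
Local Open Scope ring_scope.

(* A linear second-order q-difference equation, read formally: at the point z,
   a linear form in the three symbols y(z/q), y(qz), y(z), taken in this order.
   Treating the three values as independent keeps the coefficients well defined
   even when z/q, qz and z coincide. *)
Definition qform (R : realType) : Type := R[i] -> R[i] -> R[i] -> R[i] -> R[i].

(* The effect of y(z) = m(z) * ytilde(z). *)
Definition gauge (R : realType) (q : R[i]) (m : R[i] -> R[i]) (E : qform R) :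
    qform R :=
  fun z ydn yup y0 => E z (m (z / q) * ydn) (m (q * z) * yup) (m z * y0).

(* Coefficients are rational functions of z; they converge when they do so
   pointwise off a finite set of z (which accounts for the poles).
   The multiplier N / D depends on z but not on e.  R[i]^o is R[i] with the
   topology of its modulus. *)
Definition tends_to (R : realType) (E : R[i] -> qform R) (E0 : qform R) : Prop :=
  exists N D : {poly R[i]}, [/\ N != 0, D != 0 &
    exists S : seq R[i], forall z : R[i], z \notin S ->
      [/\ N.[z] / D.[z] * E e z 1 0 0 @[e --> (0 : R[i]^o)^'] --> (E0 z 1 0 0 : R[i]^o),
          N.[z] / D.[z] * E e z 0 1 0 @[e --> (0 : R[i]^o)^'] --> (E0 z 0 1 0 : R[i]^o)
        & N.[z] / D.[z] * E e z 0 0 1 @[e --> (0 : R[i]^o)^'] --> (E0 z 0 0 1 : R[i]^o)]].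

Section QPainleveE8.
Context (R : realType).
Local Notation C := R[i].
(* The informal u_1, ..., u_8 are u 0, ..., u 7; in particular u_1 is u ord0. *)
Context (q : C) (u : 'I_8 -> C) (h1 h2 : C).
Local Notation u1 := (u ord0).

Definition U (z : C) : C := \prod_(i < 8) (z - u i).

Definition is_Pn (P : {poly C}) : Prop :=
  size P = 5%N /\
  forall z : C, z != 0 ->
    (z - h2 / z) * P.[z + h2 / z] = U z / z ^+ 3 - (z / h2) ^+ 3 * U (h2 / z).

Definition is_Pd (P : {poly C}) : Prop :=
  size P = 5%N /\
  forall z : C, z != 0 ->
    (z - h2 / z) * P.[z + h2 / z] = z ^+ 5 * U (h2 / z) - (h2 / z) ^+ 5 * U z.

Definition psi_n (f1 f2 g : C) : C :=
  (f1 - g) * (f2 - g) - (h1 / q - h2) * (h1 - h2) * (1 / h2).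

Definition psi_d (f1 f2 g : C) : C :=
  (f1 / h1 * q - g / h2) * (f2 / h1 - g / h2)
  - (q / h1 - 1 / h2) * (1 / h1 - 1 / h2) * h2.

Definition V (Pn Pd : {poly C}) (f1 f2 g : C) : C :=
  q * psi_n f1 f2 g * Pd.[g] - h1 ^+ 2 * h2 ^+ 4 * psi_d f1 f2 g * Pn.[g].

Definition phi (f g : C) : C :=
  (f - g) * (f / h1 - g / h2) - (h1 - h2) * (1 / h1 - 1 / h2).

(* The functions f(x), g(x), as opposed to the parameters f, g. *)
Definition f_fun (x : C) : C := x + h1 / x.
Definition g_fun (x : C) : C := x + h2 / x.
Definition fbar_fun (x : C) : C := x + h1 / (q * x).

Definition L1 (Pn Pd : {poly C}) (f g : C) : qform R := fun z ydn yup y0 =>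
  q ^+ 5 * U (z / q) / ((z ^+ 2 - h1 * q ^+ 2) * (f - f_fun (z / q)))
    * (ydn - (g - g_fun (q * h1 / z)) / (g - g_fun (z / q)) * y0)
  + z ^+ 8 * U (h1 / z) / (h1 ^+ 4 * (z ^+ 2 - h1) * (f - f_fun z))
    * (yup - (g - g_fun z) / (g - g_fun (h1 / z)) * y0)
  + (h1 - h2) * z ^+ 2 * (z ^+ 2 - q * h1) * V Pn Pd (fbar_fun (z / q)) f g
    / (q * h1 ^+ 3 * h2 ^+ 3 * g * phi f g
       * (g - g_fun (h1 / z)) * (g - g_fun (z / q))) * y0.

Definition multiplier (z : C) : C := (z - q * u1) * (u1 * z - h1) / z.

Definition Bminus (z : C) : C :=
  (z - q ^+ 2 * u1)
  / (q ^+ 2 * h1 * z ^+ 2 * (z ^+ 2 - q * h1) * (z ^+ 2 - q ^+ 2 * h1))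
  * \prod_(j < 8 | j != ord0) (z - q * u j).

Definition Bplus (z : C) : C :=
  q * (q * u1 * z - h1)
  / (h1 ^+ 5 * z ^+ 2 * (z ^+ 2 - q * h1) * (z ^+ 2 - h1))
  * \prod_(j < 8 | j != ord0) (u j * z - h1).

(* rq, rU, rh1 are the chosen square roots of q, u_1...u_8 and h1. *)
Definition Bzero (rq rU rh1 : C) (z : C) : C :=
  - q * z * (rh1 - q * u1) / (2 * rh1 ^+ 7 * (z - rh1) * (z - q * rh1))
    * \prod_(j < 8 | j != ord0) (rh1 - u j)
  + q * z * (rh1 + q * u1) / (2 * rh1 ^+ 7 * (z + rh1) * (z + q * rh1))
    * \prod_(j < 8 | j != ord0) (rh1 + u j)
  - rq ^+ 3 / h1 * rU
    * ((q + 1) * (z ^+ 2 / (q * h1) ^+ 2 + 1 / z ^+ 2)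
       - (z / (q * h1) + 1 / z)
         * (q * (u1 / h1) + 1 / (q * u1)
            + \sum_(j < 8 | j != ord0) (u j / h1 + 1 / u j))).

Definition C0 : C :=
  q * (h2 - h1) / (h1 ^+ 2 * u1 * (h1 - u1 ^+ 2) * (h2 - u1 ^+ 2))
  * \prod_(j < 8 | j != ord0) (u1 - u j).

(* The limit equation, all terms on one side; c is the accessory constant. *)
Definition limit_eq (rq rU rh1 c : C) : qform R := fun z ydn yup y0 =>
  Bminus z * ydn + Bplus z * yup + Bzero rq rU rh1 z * y0 - c * y0.

End QPainleveE8.

(* Main.v *)
(** Put a = u_1 + e c_1, b = u_1 + e c_2, w = h_2/u_1, x = z/q, x' = h_1/(q x) and
    U(t) = (t - u_1) U'(t).  The curve phi = 0 is parametrised by (f(t), g(t)), so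
    phi(f(a), g(b)) contains the factor f(a) - f(b); by the functional equations of
    P_n and P_d so does the part of V(_, f(a); g(b)) carrying U(h_2/b), while the
    other part carries U(b) = e c_2 U'(b).  Hence V/phi is regular at e = 0, and c_1,
    c_2 survive only in the ratio c_2/(c_1 - c_2), which comes with the constant C_0.
    The rest of the limiting coefficient of y(z) is
    Phi(x) U'(x) + Phi(x') U'(x') + Psi(x) U'(w), which is linear in U', so that
    comparing it with B^0 reduces to U' = t^k, k < 8.  Each of these splits into a
    part with poles at z = +- h_1^(1/2), +- q h_1^(1/2), a Laurent polynomial in z,
    and a constant; the constants add up to - C_0'. *)

Require Import Defs.
From HB Require Import structures.
From mathcomp Require Import all_boot all_order all_algebra.
From mathcomp Require Import complex.
From mathcomp Require Import all_classical all_reals all_analysis.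
From mathcomp Require Import ring.
Import Order.TTheory GRing.Theory Num.Theory.
Import numFieldNormedType.Exports.
Local Open Scope ring_scope.

Set Implicit Arguments.
Unset Strict Implicit.
Unset Printing Implicit Defensive.

(** Carries a known nonvanishing over to the shape in which [field] asks for it; what is left is a
    plain identity. *)
Lemma neq0_eq (W : zmodType) (a b : W) : b != 0 -> a = b -> a != 0.
Proof. by move=> b0 ->. Qed.

Lemma neq0_opp (W : zmodType) (a b : W) : b != 0 -> a = - b -> a != 0.
Proof. by move=> b0 ->; rewrite oppr_eq0. Qed.

(** * Partial fractions of the central coefficient in x = z/q *)

Section CoefficientIdentity.
Context (F : fieldType) (q u1 w h1 s : F).

Definition Phi (x : F) : F :=
  q * (h1 - w * x) * (q * u1 * x - h1)
  / (h1 ^+ 2 * x ^+ 2 * (q * x ^+ 2 - h1) * (x ^+ 2 - h1) * (x - w)).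

Definition Psi (x : F) : F :=
  q * (q * u1 * x - h1) * (x - u1)
  / (h1 ^+ 2 * w ^+ 2 * (u1 - w) * (h1 - q * w * x) * (x - w)).

Definition polar_part (x t : F) : F :=
  - (q * (q * x) * (t - q * u1)) / (2 * t ^+ 7 * (q * x - t) * (q * x - q * t)).

(** Only k = 0, 1, 6, 7 contribute, since [Phi] has order x^-2 at 0 and x^-5 at infinity. *)
Definition laurent_part (x : F) (k : nat) : F :=
  let x' := h1 / (q * x) in
  nth 0 [:: q / (h1 ^+ 2 * w)
             * (x^-1 ^+ 2 + x'^-1 ^+ 2
                + (w^-1 - w / h1 - q * u1 / h1) * (x^-1 + x'^-1));
            q / (h1 ^+ 2 * w) * (x^-1 + x'^-1); 0; 0; 0; 0;
            - (q * u1 * w / h1 ^+ 2) * (x + x');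
            - (q * u1 * w / h1 ^+ 2)
             * (x ^+ 2 + x' ^+ 2 + (w - h1 / w - h1 / (q * u1)) * (x + x'))] k.

(** The factor in front of w^k is the common value of [Psi] at 0 and infinity. *)
Definition const_part (k : nat) : F :=
  nth 0 [:: q / (h1 ^+ 2 * w)
             * (q * u1 * w / h1 ^+ 2 + q / h1 + w^-1 ^+ 2 - q * u1 / (h1 * w));
            q / (h1 ^+ 2 * w) * (w^-1 - w / h1 - q * u1 / h1);
            q / (h1 ^+ 2 * w); 0; 0;
            - (q * u1 * w / h1 ^+ 2);
            - (q * u1 * w / h1 ^+ 2) * (w - h1 / w - h1 / (q * u1));
            - (q * u1 * w / h1 ^+ 2)
             * (h1 ^+ 2 / (q * u1 * w) + h1 / q + w ^+ 2 - w * h1 / (q * u1))] k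
  - q * u1 / (h1 ^+ 2 * w ^+ 3 * (u1 - w)) * w ^+ k.

(** Both sides are invariant under x <-> x' = h1/(qx). The poles at x = w and x' = w cancel between
    [Phi] and [Psi], those at x = x' between the two [Phi] terms. There remain the poles at x = +-s,
    x' = +-s and the expansions at 0 and infinity. *)
Lemma monomial_identity (x : F) (k : nat) :
  s ^+ 2 = h1 -> 2 != 0 :> F -> q != 0 -> u1 != 0 -> w != 0 -> s != 0 -> x != 0 ->
  u1 - w != 0 -> x - w != 0 -> h1 - q * w * x != 0 ->
  q * x - s != 0 -> q * x + s != 0 -> x - s != 0 -> x + s != 0 ->
  q * x ^+ 2 - h1 != 0 -> (k < 8)%N ->
  Phi x * x ^+ k + Phi (h1 / (q * x)) * (h1 / (q * x)) ^+ k + Psi x * w ^+ k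
  = polar_part x s * s ^+ k + polar_part x (- s) * (- s) ^+ k
    + laurent_part x k + const_part k.
Proof.
move=> sE; rewrite /Phi /Psi /polar_part /laurent_part /const_part -{}sE.
move=> n2 q0 u10 w0 s0 x0 uw xw hwx qxs qxNs xs xNs qx2.
have x2 : x ^+ 2 - s ^+ 2 != 0.
  by rewrite (_ : _ - _ = (x - s) * (x + s)) ?mulf_neq0 //; ring.
(* This and the next fact concern q x'^2 - h1 and x'^2 - h1, cleared of q and x, as [field] presents
   them. *)
have s4 : s ^+ 4 + - s ^+ 2 * (q * x ^+ 2) != 0.
  rewrite (_ : _ + _ = - (s ^+ 2 * (q * x ^+ 2 - s ^+ 2))); last by ring.
  by rewrite oppr_eq0 !mulf_neq0.
have qx : (s ^+ 2) ^+ 2 + - s ^+ 2 * (q * x) ^+ 2 != 0.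
  rewrite (_ : _ + _ = - (s ^+ 2 * ((q * x - s) * (q * x + s)))); last by ring.
  by rewrite oppr_eq0 !mulf_neq0.
have qs t : q * x - q * t = q * (x - t) by ring.
case: k => [|[|[|[|[|[|[|[|//]]]]]]]] _ /=; field;
  rewrite !qs !opprK n2 q0 w0 s0 x0 uw xw hwx qxs qxNs qx2 x2 s4 qx;
  by rewrite ?u10 ?oppr_eq0 ?s0 ?(mulf_neq0 q0 xs) ?(mulf_neq0 q0 xNs).
Qed.

Lemma polynomial_identity (P : {poly F}) (x : F) : (size P <= 8)%N ->
  s ^+ 2 = h1 -> 2 != 0 :> F -> q != 0 -> u1 != 0 -> w != 0 -> s != 0 -> x != 0 ->
  u1 - w != 0 -> x - w != 0 -> h1 - q * w * x != 0 ->
  q * x - s != 0 -> q * x + s != 0 -> x - s != 0 -> x + s != 0 ->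
  q * x ^+ 2 - h1 != 0 ->
  Phi x * P.[x] + Phi (h1 / (q * x)) * P.[h1 / (q * x)] + Psi x * P.[w]
  = polar_part x s * P.[s] + polar_part x (- s) * P.[- s]
    + \sum_(k < 8) P`_k * laurent_part x k + \sum_(k < 8) P`_k * const_part k.
Proof.
move=> sP sE n2 q0 u10 w0 s0 x0 uw xw hwx qxs qxNs xs xNs qx2.
rewrite !(horner_coef_wide _ sP) !big_distrr -!big_split /=.
apply: eq_bigr => k _; rewrite !(mulrCA _ P`_k) -!mulrDr.
by rewrite monomial_identity.
Qed.

(** The logarithmic derivative at 0; it will supply the sum of the 1/u_j in B^0. *)
Lemma coef1_prod_XsubC (r : seq F) : all (fun c => c != 0) r ->
  (\prod_(c <- r) ('X - c%:P))`_1
  = - (\prod_(c <- r) ('X - c%:P))`_0 * \sum_(c <- r) c^-1.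
Proof.
elim: r => [|c r IHr] /=; first by rewrite !big_nil coef1 mulr0.
move=> /andP[c0 /IHr rE]; rewrite !big_cons !mulrBl !coefB !coefXM !coefCM /= rE.
by field.
Qed.

End CoefficientIdentity.

Local Open Scope classical_set_scope.

(** * Continuity at e = 0 and limits *)

Section ContinuityAtZero.
Context (K : numFieldType).
Implicit Types f g : K -> K.

Definition cont0 f : Prop := {for (0 : K^o), continuous (f : K^o -> K^o)}.

Lemma cont0_cst c : cont0 (fun=> c).
Proof. exact: cst_continuous. Qed.

Lemma cont0_id : cont0 id.
Proof. by []. Qed.

Lemma cont0D f g : cont0 f -> cont0 g -> cont0 (fun e => f e + g e).
Proof. exact: (@continuousD K K^o K^o). Qed.

Lemma cont0N f : cont0 f -> cont0 (fun e => - f e).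
Proof. exact: (@continuousN K K^o K^o). Qed.

Lemma cont0M f g : cont0 f -> cont0 g -> cont0 (fun e => f e * g e).
Proof. exact: (@continuousM K K^o). Qed.

Lemma cont0V f : cont0 f -> f 0 != 0 -> cont0 (fun e => (f e)^-1).
Proof. by move=> cf f0; exact: (@continuousV K K^o _ _ f0 cf). Qed.

Lemma cont0X f n : cont0 f -> cont0 (fun e => f e ^+ n).
Proof.
move=> cf; elim: n => [|n IHn]; first exact: cont0_cst.
under eq_fun do rewrite exprS.
exact: cont0M.
Qed.

Lemma cont0_prod (I : Type) (r : seq I) (P : pred I) (f : I -> K -> K) :
  (forall i, cont0 (f i)) -> cont0 (fun e => \prod_(i <- r | P i) f i e).
Proof.
move=> cf; elim: r => [|i r IHr].
  under eq_fun do rewrite big_nil.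
  exact: cont0_cst.
under eq_fun do rewrite big_cons.
by case: (P i) => //; exact: cont0M.
Qed.

Lemma cont0_neq0 f : cont0 f -> f 0 != 0 -> \forall e \near (0 : K^o)^', f e != 0.
Proof.
move=> cf f0; apply: nbhs_dnbhs.
exact: (cvgr_neq0 (f 0 : K^o) cf f0).
Qed.

End ContinuityAtZero.

(** A coefficient may have the form 0/0 at e = 0; its limit is the value there of a continuous
    function equal to it nearby. *)
Lemma cont0_cvg (R : realType) (f g : R[i] -> R[i]) (l : R[i]) :
  cont0 g -> (\forall e \near (0 : R[i]^o)^', g e = f e) -> g 0 = l ->
  f e @[e --> (0 : R[i]^o)^'] --> (l : R[i]^o).
Proof.
move=> cg gf <-; apply: cvg_trans (near_eq_cvg gf) _.
by apply: cvg_trans cg; apply: cvg_fmap2; exact: nbhs_dnbhs.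
Qed.

Lemma tends_to_cont0 (R : realType) (E : R[i] -> qform R) (E0 : qform R)
    (N D : {poly R[i]}) (S : seq R[i]) : N != 0 -> D != 0 ->
  (forall z, z \notin S -> exists g1 g2 g3 : R[i] -> R[i],
    [/\ [/\ cont0 g1, cont0 g2 & cont0 g3],
        \forall e \near (0 : R[i]^o)^',
          [/\ g1 e = N.[z] / D.[z] * E e z 1 0 0,
              g2 e = N.[z] / D.[z] * E e z 0 1 0
            & g3 e = N.[z] / D.[z] * E e z 0 0 1]
      & [/\ g1 0 = E0 z 1 0 0, g2 0 = E0 z 0 1 0 & g3 0 = E0 z 0 0 1]]) ->
  tends_to E E0.
Proof.
move=> N0 D0 EE; exists N, D; split=> //; exists S => z /EE.
move=> [g1 [g2 [g3 [[c1 c2 c3] gE [l1 l2 l3]]]]]; split.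
- by apply: cont0_cvg c1 _ l1; apply: filterS gE => e [].
- by apply: cont0_cvg c2 _ l2; apply: filterS gE => e [].
- by apply: cont0_cvg c3 _ l3; apply: filterS gE => e [].
Qed.

(** Descends through the expression with hypotheses [cont0 f] as atoms; the goals left over say that
    inverted factors do not vanish at 0. *)
Ltac continuity0 :=
  repeat lazymatch goal with
  | H : cont0 ?f |- cont0 ?f => exact: H
  | H : cont0 ?f |- cont0 (fun e => ?f e) => exact: H
  | |- cont0 (fun _ => ?c) => exact: cont0_cst
  | |- cont0 (fun e => e) => exact: cont0_id
  | |- cont0 (fun e => @?f e + @?g e) => apply: (@cont0D _ f g)
  | |- cont0 (fun e => - @?f e) => apply: (@cont0N _ f)
  | |- cont0 (fun e => @?f e * @?g e) => apply: (@cont0M _ f g)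
  | |- cont0 (fun e => (@?f e) ^+ ?n) => apply: (@cont0X _ f n)
  | |- cont0 (fun e => (@?f e)^-1) => apply: (@cont0V _ f)
  | |- cont0 (fun e => \prod_(i <- ?r | @?P i) @?f i e) =>
      apply: (@cont0_prod _ _ r P f) => ?
  end; cbv beta.

(** * Cancellation of f(a) - f(b) in V/phi *)

Section Degeneration.
Context (R : realType) (q : R[i]) (u : 'I_8 -> R[i]) (h1 h2 : R[i]).
Hypotheses (q_neq0 : q != 0) (h1_neq0 : h1 != 0) (h2_neq0 : h2 != 0).
Local Notation C := R[i].
Local Notation u1 := (u ord0).
Local Notation f_ := (f_fun h1).
Local Notation g_ := (g_fun h2).

(** Since g(b) = g(h2/b), the roots of the quadratic phi(., g(b)) are f(b) and f(h2/b) = h2/b + b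
    h1/h2. *)
Lemma phi_fg (a b : C) : a != 0 -> b != 0 ->
  phi h1 h2 (f_ a) (g_ b) = (f_ a - f_ b) * ((f_ a - h2 / b - b * h1 / h2) / h1).
Proof.
move=> a0 b0; rewrite /phi /f_fun /g_fun; field.
by rewrite a0 b0 h1_neq0 h2_neq0.
Qed.

(** This combination multiplies U(h2/b) in V; it is affine in f(a) and vanishes for f(a) = f(b). *)
Lemma psi_fg (a b X : C) : a != 0 -> b != 0 ->
  q * b ^+ 2 * psi_n q h1 h2 X (f_ a) (g_ b)
    + h1 ^+ 2 * h2 * psi_d q h1 h2 X (f_ a) (g_ b)
  = (f_ a - f_ b) * (g_ b * (q * b * X - q * b ^+ 2 - h1)).
Proof.
move=> a0 b0; rewrite /psi_n /psi_d /f_fun /g_fun; field.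
by rewrite a0 b0 h1_neq0 h2_neq0 q_neq0.
Qed.

Lemma V_g (Pn Pd : {poly C}) (b X f : C) :
  is_Pn u h2 Pn -> is_Pd u h2 Pd -> b != 0 -> b - h2 / b != 0 ->
  V q h1 h2 Pn Pd X f (g_ b) =
  (U u (h2 / b) * b ^+ 3 * (q * b ^+ 2 * psi_n q h1 h2 X f (g_ b)
                            + h1 ^+ 2 * h2 * psi_d q h1 h2 X f (g_ b))
   - U u b / b ^+ 3 * (q * h2 ^+ 5 / b ^+ 2 * psi_n q h1 h2 X f (g_ b)
                       + h1 ^+ 2 * h2 ^+ 4 * psi_d q h1 h2 X f (g_ b)))
  / (b - h2 / b).
Proof.
move=> [_ PnE] [_ PdE] b0 bh; apply: (mulIf bh); rewrite divfK // /V.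
transitivity (q * psi_n q h1 h2 X f (g_ b) * ((b - h2 / b) * Pd.[g_ b])
  - h1 ^+ 2 * h2 ^+ 4 * psi_d q h1 h2 X f (g_ b) * ((b - h2 / b) * Pn.[g_ b])).
  by ring.
(* Only the arguments of [Pd] and [Pn] are unfolded, to match the functional equations at z = b. *)
rewrite {2 4}/g_fun PnE // PdE //.
field; by rewrite b0 h2_neq0.
Qed.

Lemma f_sub (a b : C) : a != 0 -> b != 0 ->
  f_ a - f_ b = (a - b) * ((a * b - h1) / (a * b)).
Proof. by move=> a0 b0; rewrite /f_fun; field; rewrite a0 b0. Qed.

Lemma g_sub (a b : C) : a != 0 -> b != 0 ->
  g_ a - g_ b = (a - b) * ((a * b - h2) / (a * b)).
Proof. by move=> a0 b0; rewrite /g_fun; field; rewrite a0 b0. Qed.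

Definition U' (x : C) : C := \prod_(j < 8 | j != ord0) (x - u j).

Lemma UE (x : C) : U u x = (x - u1) * U' x.
Proof. by rewrite /U (bigD1 ord0). Qed.

(** V/phi after division of both by f(a) - f(b), hence meaningful at a = b = u_1. Here k stands for
    c_2/(c_1 - c_2), and the last factor of the denominator is f(a) - f(h2/b). *)
Definition V_over_phi (k X a b : C) : C :=
  h1 * (U u (h2 / b) * b ^+ 3 * (g_ b * (q * b * X - q * b ^+ 2 - h1))
        - k * (U' b / b ^+ 3 * (a * b / (a * b - h1))
           * (q * h2 ^+ 5 / b ^+ 2 * psi_n q h1 h2 X (f_ a) (g_ b)
              + h1 ^+ 2 * h2 ^+ 4 * psi_d q h1 h2 X (f_ a) (g_ b))))
  / ((b - h2 / b) * (f_ a - h2 / b - b * h1 / h2)).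

Lemma V_over_phiE (Pn Pd : {poly C}) (X e c1 c2 : C) :
  let a := u1 + e * c1 in let b := u1 + e * c2 in
  is_Pn u h2 Pn -> is_Pd u h2 Pd -> e != 0 -> c1 - c2 != 0 ->
  a != 0 -> b != 0 -> b - h2 / b != 0 -> a * b - h1 != 0 ->
  V q h1 h2 Pn Pd X (f_ a) (g_ b) / phi h1 h2 (f_ a) (g_ b)
  = V_over_phi (c2 / (c1 - c2)) X a b.
Proof.
move=> a b PnE PdE e0 c12 a0 b0 bh ab.
have abE : a - b = e * (c1 - c2) by rewrite /a /b; ring.
have ff : f_ a - f_ b = e * (c1 - c2) * ((a * b - h1) / (a * b)).
  by rewrite f_sub // abE.
have ff0 : f_ a - f_ b != 0.
  by rewrite ff !mulf_neq0 // invr_neq0 // mulf_neq0.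
(* As b - u_1 = e c_2 and a - b = e (c_1 - c_2), e drops out of U(b)/(f(a) - f(b)). *)
have Ub : U u b = c2 / (c1 - c2) * U' b * (a * b / (a * b - h1)) * (f_ a - f_ b).
  rewrite UE ff (_ : b - u1 = e * c2); last by rewrite /b; ring.
  by field; rewrite a0 b0 c12 ab.
rewrite (V_g _ _ PnE PdE) // phi_fg // psi_fg // {1}Ub /V_over_phi.
(* Large subterms become atoms, so that [field] merely cancels d = f(a) - f(b). *)
move: (psi_n _ _ _ _ _ _) (psi_d _ _ _ _ _ _) (U u _) (U' _) => pn pd uh ub.
move: (f_ a - f_ b) ff0 => d d0.
move: (a * b / (a * b - h1)) (c2 / (c1 - c2)) => r k.
rewrite !invfM !invrK.
move: (f_ a - h2 / b - b * h1 / h2)^-1 (b - h2 / b)^-1 => i1 i2.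
by field; rewrite b0 d0.
Qed.

(** * Coefficients of the equation and of the polynomial U' *)

Local Notation w := (h2 / u1).
Local Notation mult z := (- q / (u1 * h1) / (z ^+ 2 * (z ^+ 2 - q * h1))).

Definition coef_down (f z : C) : C :=
  q ^+ 5 * U u (z / q) / ((z ^+ 2 - h1 * q ^+ 2) * (f - f_ (z / q))).

Definition coef_up (f z : C) : C :=
  z ^+ 8 * U u (h1 / z) / (h1 ^+ 4 * (z ^+ 2 - h1) * (f - f_ z)).

(** The argument [v] stands for V/phi, so that its regular form can be substituted. *)
Definition coef_center (f g v z : C) : C :=
  - coef_down f z * ((g - g_ (q * h1 / z)) / (g - g_ (z / q)))
  - coef_up f z * ((g - g_ z) / (g - g_ (h1 / z)))
  + (h1 - h2) * z ^+ 2 * (z ^+ 2 - q * h1) * v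
    / (q * h1 ^+ 3 * h2 ^+ 3 * g * (g - g_ (h1 / z)) * (g - g_ (z / q))).

Lemma L1E (Pn Pd : {poly C}) (f g z ydn yup y0 : C) :
  L1 q u h1 h2 Pn Pd f g z ydn yup y0 = coef_down f z * ydn + coef_up f z * yup
    + coef_center f g (V q h1 h2 Pn Pd (fbar_fun q h1 (z / q)) f g / phi h1 h2 f g) z * y0.
Proof.
rewrite /L1 /coef_center /coef_down /coef_up !invfM.
ring.
Qed.

Definition U'_poly : {poly C} := \prod_(j < 8 | j != ord0) ('X - (u j)%:P).

Lemma horner_U'_poly (x : C) : U'_poly.[x] = U' x.
Proof.
by rewrite horner_prod; apply: eq_bigr => j _; rewrite hornerXsubC.
Qed.

Lemma U'_opp (x : C) : U' (- x) = - \prod_(j < 8 | j != ord0) (x + u j).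
Proof.
rewrite /U' (eq_bigr (fun j => - (x + u j))); last by move=> j _; rewrite opprD.
by rewrite prodrN cardC1 card_ord -signr_odd mulN1r.
Qed.

Lemma U'_scale (x c : C) :
  \prod_(j < 8 | j != ord0) (c * x - c * u j) = c ^+ 7 * U' x.
Proof.
rewrite /U' (eq_bigr (fun j => c * (x - u j))); last by move=> j _; rewrite mulrBr.
by rewrite big_split /= prodr_const cardC1 card_ord.
Qed.

Lemma U'_rev (x c : C) : x != 0 ->
  \prod_(j < 8 | j != ord0) (u j * x - c) = - x ^+ 7 * U' (c / x).
Proof.
move=> x0; rewrite /U' (eq_bigr (fun j => - x * (c / x - u j))).
  by rewrite big_split /= prodr_const cardC1 card_ord -mulN1r exprMn -signr_odd; ring.
by move=> j _; field.
Qed.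

(** Vieta's formulas for the coefficients that [laurent_part] picks out, with the product of u_2,
    ..., u_8 eliminated by the balancing condition. *)
Lemma U'_poly_coefs : (forall i, u i != 0) ->
  h1 ^+ 2 * h2 ^+ 2 = q * \prod_(i < 8) u i ->
  [/\ size U'_poly = 8, U'_poly`_7 = 1,
      U'_poly`_0 = - (h1 ^+ 2 * h2 ^+ 2 / (q * u1))
    & \sum_(j < 8 | j != ord0) (u j / h1 + 1 / u j)
      = - U'_poly`_6 / h1 + q * u1 / (h1 ^+ 2 * h2 ^+ 2) * U'_poly`_1].
Proof.
move=> u0 balance.
pose r := [seq u j | j <- index_enum 'I_8 & j != ord0].
have rE : U'_poly = \prod_(c <- r) ('X - c%:P) by rewrite big_map big_filter.
have size_r : size r = 7%N.
  by rewrite size_map -sum1_size big_filter sum1_card cardC1 card_ord.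
have U'0 : U'_poly`_0 = - (h1 ^+ 2 * h2 ^+ 2 / (q * u1)).
  (* Writing 0 as -0 lets [U'_opp] evaluate U'(0). *)
  rewrite -horner_coef0 horner_U'_poly -(oppr0 C) U'_opp balance.
  have -> : \prod_(i < 8) u i = u1 * \prod_(j < 8 | j != ord0) (0 + u j).
    by rewrite (bigD1 ord0) //=; under [in RHS]eq_bigr do rewrite add0r.
  by field; rewrite q_neq0 u0.
have sP : size U'_poly = 8%N by rewrite rE size_prod_XsubC size_r.
split => //.
  have : lead_coef U'_poly = 1.
    by apply/eqP; rewrite -[_ == _]/(_ \is monic) rE monic_prod_XsubC.
  by rewrite lead_coefE sP.
have P6 : U'_poly`_6 = - \sum_(c <- r) c.
  by rewrite rE -coefPn_prod_XsubC size_r.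
have P1 : U'_poly`_1 = - U'_poly`_0 * \sum_(c <- r) c^-1.
  by rewrite rE coef1_prod_XsubC //; apply/allP => _ /mapP[j _ ->].
rewrite P6 P1 U'0 !big_map !big_filter big_split /= -big_distrl /=.
under [X in _ + X = _]eq_bigr do rewrite div1r.
by field; rewrite h1_neq0 h2_neq0 q_neq0 u0.
Qed.

Lemma BzeroE (rq rU s x : C) : (forall i, u i != 0) ->
  h1 ^+ 2 * h2 ^+ 2 = q * \prod_(i < 8) u i ->
  rq ^+ 2 = q -> rq * rU = h1 * h2 -> s ^+ 2 = h1 -> x != 0 ->
  polar_part q u1 x s * U'_poly.[s] + polar_part q u1 x (- s) * U'_poly.[- s]
    + \sum_(k < 8) U'_poly`_k * laurent_part q u1 w h1 x k
  = Bzero q u h1 rq rU s (q * x).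
Proof.
move=> u0 balance rqE rqU sE x0.
have [_ P7 P0 sumE] := U'_poly_coefs u0 balance.
(* The roots of q and of u_1...u_8 enter B^0 only through this product. *)
have rE : rq ^+ 3 / h1 * rU = q * h2.
  rewrite (_ : _ * _ = rq ^+ 2 * (rq * rU) / h1); last by ring.
  by rewrite rqE rqU; field.
rewrite /Bzero sumE rE !horner_U'_poly U'_opp -/(U' s).
rewrite !big_ord_recl big_ord0 /= /laurent_part /= P7 P0.
have -> : polar_part q u1 x s
    = - q * (q * x) * (s - q * u1) / (2 * s ^+ 7 * (q * x - s) * (q * x - q * s)).
  by rewrite /polar_part; ring.
have -> : polar_part q u1 x (- s)
    = - (q * (q * x) * (s + q * u1) / (2 * s ^+ 7 * (q * x + s) * (q * x + q * s))).
  rewrite /polar_part (_ : 2 * (- s) ^+ 7 * _ * _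
    = - (2 * s ^+ 7 * (q * x + s) * (q * x + q * s))); last by ring.
  by rewrite invrN; ring.
rewrite mulrNN -!addrA; congr (_ + (_ + _)).
by field; rewrite q_neq0 h1_neq0 h2_neq0 u0.
Qed.

(** * Normalised coefficients at e = 0, with z = q x *)

Section Coefficients.
Context (x : C).
Local Notation z := (q * x).
Hypotheses (u1_neq0 : u1 != 0) (u1_h1 : u1 ^+ 2 - h1 != 0)
  (u1_h2 : u1 ^+ 2 - h2 != 0) (u1_Nh2 : u1 ^+ 2 + h2 != 0) (h12 : h2 - h1 != 0).
Hypotheses (x_neq0 : x != 0) (zh1 : q * x ^+ 2 - h1 != 0)
  (xh1 : x ^+ 2 - h1 != 0) (zzh1 : z ^+ 2 - h1 != 0)
  (u1x : u1 - x != 0) (u1xh1 : u1 * x - h1 != 0) (u1xh2 : u1 * x - h2 != 0)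
  (u1z : u1 - z != 0) (u1zh1 : u1 * z - h1 != 0) (u1h1z : u1 * h1 - h2 * z != 0).

Let zq : z / q = x.
Proof. by field. Qed.

(** The zeros of f - f(x) are cancelled by those of U(x) and g - g(h1/x), and the gauge factor z - q
    u_1 cancels the zero of g - g(x) at x = u_1. *)
Lemma center_down :
  mult z * (- coef_down (f_ u1) z * ((g_ u1 - g_ (q * h1 / z)) / (g_ u1 - g_ x))
    * multiplier q u h1 z)
  = Phi q u1 w h1 x * U' x.
Proof.
rewrite /coef_down zq UE !f_sub // !g_sub // ?mulf_neq0 ?invr_neq0 ?mulf_neq0 //.
rewrite /multiplier /Phi; move: (U' x) => t.
field.
have -> : x * u1 - h2 != 0 by apply: (neq0_eq u1xh2); ring.
have -> : z ^+ 2 - h1 * q ^+ 2 != 0.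
  by apply: (neq0_eq (mulf_neq0 (mulf_neq0 q_neq0 q_neq0) xh1)); ring.
have -> : z ^+ 2 - q * h1 != 0.
  by apply: (neq0_eq (mulf_neq0 q_neq0 zh1)); ring.
by rewrite u1_neq0 xh1 zh1 x_neq0 h1_neq0 q_neq0 u1x u1xh1.
Qed.

(** The same cancellations with h1/z in place of x; now the gauge factor u_1 z - h1 is the one that
    matters. *)
Lemma center_up :
  mult z * (- coef_up (f_ u1) z * ((g_ u1 - g_ z) / (g_ u1 - g_ (h1 / z)))
    * multiplier q u h1 z)
  = Phi q u1 w h1 (h1 / z) * U' (h1 / z).
Proof.
rewrite /coef_up UE !f_sub // ?g_sub // ?mulf_neq0 ?invr_neq0 ?mulf_neq0 //.
rewrite /multiplier /Phi; move: (U' _) => t.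
field.
have -> : h1 * u1 + - h2 * z != 0 by apply: (neq0_eq u1h1z); ring.
have -> : h1 ^+ 2 + - h1 * z ^+ 2 != 0.
  by apply: (neq0_opp (mulf_neq0 h1_neq0 zzh1)); ring.
have -> : h1 ^+ 2 + - h1 * (q * x ^+ 2) != 0.
  by apply: (neq0_opp (mulf_neq0 h1_neq0 zh1)); ring.
have -> : z ^+ 2 - q * h1 != 0.
  by apply: (neq0_eq (mulf_neq0 q_neq0 zh1)); ring.
by rewrite u1_neq0 x_neq0 q_neq0 h1_neq0 u1zh1 u1z zzh1.
Qed.

(** For X = x + h1/(qx), q t X - q t^2 - h1 = (x - t)(q t x - h1)/x. With t = u_1 this gives the
    numerator of [Psi]. The bracket after k contains the same expression with t = w, by [psi_fg] at
    h2/b; with the gauge factor it cancels both differences of g, so that the term in k is free of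
    z. *)
Lemma center_V (k : C) :
  mult z * ((h1 - h2) * z ^+ 2 * (z ^+ 2 - q * h1)
    * V_over_phi k (fbar_fun q h1 x) u1 u1
    / (q * h1 ^+ 3 * h2 ^+ 3 * g_ u1 * (g_ u1 - g_ (h1 / z)) * (g_ u1 - g_ x))
    * multiplier q u h1 z)
  = Psi q u1 w h1 x * U' w - C0 q u h1 h2 * k.
Proof.
rewrite !g_sub // ?mulf_neq0 ?invr_neq0 ?mulf_neq0 //.
rewrite /V_over_phi UE /C0 -/(U' u1) /multiplier /Psi /psi_n /psi_d /f_fun /g_fun /fbar_fun.
move: (U' _) (U' _) => t t'.
field.
have -> : h2 - u1 ^+ 2 != 0 by apply: (neq0_opp u1_h2); ring.
have -> : h1 - u1 ^+ 2 != 0 by apply: (neq0_opp u1_h1); ring.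
have -> : x * u1 - h2 != 0 by apply: (neq0_eq u1xh2); ring.
have -> : h1 * u1 - q * h2 * x != 0 by apply: (neq0_eq u1h1z); ring.
have -> : u1 * u1 - h2 != 0 by apply: (neq0_eq u1_h2); ring.
have -> : u1 * u1 + h2 != 0 by apply: (neq0_eq u1_Nh2); ring.
have -> : u1 * u1 - h1 != 0 by apply: (neq0_eq u1_h1); ring.
have -> : (u1 * u1 + h1 - h2) * h2 + - (u1 * h1) * u1 != 0.
  by apply: (neq0_eq (mulf_neq0 h12 u1_h2)); ring.
have -> : z ^+ 2 - q * h1 != 0.
  by apply: (neq0_eq (mulf_neq0 q_neq0 zh1)); ring.
by rewrite u1_neq0 h1_neq0 h2_neq0 x_neq0 q_neq0 u1x u1zh1.
Qed.

Lemma down_limit :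
  mult z * (coef_down (f_ u1) z * multiplier q u h1 (z / q)) = Bminus q u h1 z.
Proof.
rewrite /Bminus U'_scale /coef_down zq UE f_sub // /multiplier; move: (U' x) => t.
field.
have -> : z ^+ 2 - q ^+ 2 * h1 != 0.
  by apply: (neq0_eq (mulf_neq0 (mulf_neq0 q_neq0 q_neq0) xh1)); ring.
have -> : z ^+ 2 - q * h1 != 0.
  by apply: (neq0_eq (mulf_neq0 q_neq0 zh1)); ring.
by rewrite x_neq0 q_neq0 h1_neq0 u1_neq0 u1xh1.
Qed.

Lemma up_limit :
  mult z * (coef_up (f_ u1) z * multiplier q u h1 (q * z)) = Bplus q u h1 z.
Proof.
have z0 : z != 0 by rewrite mulf_neq0.
rewrite /Bplus U'_rev // /coef_up UE f_sub // /multiplier; move: (U' _) => t.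
field.
have -> : z ^+ 2 - q * h1 != 0.
  by apply: (neq0_eq (mulf_neq0 q_neq0 zh1)); ring.
by rewrite zzh1 x_neq0 q_neq0 h1_neq0 u1_neq0 u1zh1.
Qed.

Lemma center_limit (rq rU s k : C) : (forall i, u i != 0) ->
  h1 ^+ 2 * h2 ^+ 2 = q * \prod_(i < 8) u i ->
  rq ^+ 2 = q -> rq * rU = h1 * h2 -> s ^+ 2 = h1 ->
  mult z * (coef_center (f_ u1) (g_ u1) (V_over_phi k (fbar_fun q h1 (z / q)) u1 u1) z
            * multiplier q u h1 z)
  = Bzero q u h1 rq rU s z
    - (C0 q u h1 h2 * k - \sum_(k < 8) U'_poly`_k * const_part q u1 w h1 k).
Proof.
move=> u0 balance rqE rqU sE.
have [sP _ _ _] := U'_poly_coefs u0 balance.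
have factor2 (a b c : C) : a ^+ 2 - b ^+ 2 != 0 -> a - b != 0 /\ a + b != 0.
  by rewrite subr_sqr mulf_eq0 negb_or => /andP.
have [qxs qxNs] : z - s != 0 /\ z + s != 0 by apply: factor2; rewrite // sE.
have [xs xNs] : x - s != 0 /\ x + s != 0 by apply: factor2; rewrite // sE.
have w0 : w != 0 by rewrite mulf_neq0 ?invr_neq0.
have uw : u1 - w != 0.
  by apply: (neq0_eq (mulf_neq0 u1_h2 (invr_neq0 u1_neq0))); field.
have xw : x - w != 0.
  by apply: (neq0_eq (mulf_neq0 u1xh2 (invr_neq0 u1_neq0))); field.
have hwx : h1 - q * w * x != 0.
  by apply: (neq0_eq (mulf_neq0 u1h1z (invr_neq0 u1_neq0))); field.
have n2 : 2 != 0 :> C by rewrite pnatr_eq0.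
have sP8 : (size U'_poly <= 8)%N by rewrite sP.
have s0 : s != 0 by apply: contraNneq h1_neq0 => s0; rewrite -sE s0 expr0n.
have := polynomial_identity sP8 sE n2 q_neq0 u1_neq0 w0 s0 x_neq0 uw xw hwx
  qxs qxNs xs xNs zh1.
rewrite (BzeroE u0 balance rqE rqU sE x_neq0) !horner_U'_poly.
rewrite -center_down -center_up => idE.
(* Read backwards, the partial fraction identity restores the three contributions to the central
   coefficient. *)
rewrite opprB addrA -idE -addrA -center_V /coef_center zq.
ring.
Qed.

End Coefficients.

(** * Continuity of the regularised coefficients *)

Section Continuity.
Context (a b : C -> C).
Hypotheses (ca : cont0 a) (cb : cont0 b) (a0 : a 0 != 0) (b0 : b 0 != 0).

Lemma cont0_f : cont0 (fun e => f_ (a e)).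
Proof.
rewrite /f_fun; by continuity0.
Qed.

Lemma cont0_g : cont0 (fun e => g_ (b e)).
Proof.
rewrite /g_fun; by continuity0.
Qed.

Lemma cont0_V_over_phi (k X : C) :
  b 0 - h2 / b 0 != 0 -> a 0 * b 0 - h1 != 0 ->
  f_ (a 0) - h2 / b 0 - b 0 * h1 / h2 != 0 ->
  cont0 (fun e => V_over_phi k X (a e) (b e)).
Proof.
move=> bh ab fb; rewrite /V_over_phi /psi_n /psi_d /U /U'.
have cf := cont0_f; have cg := cont0_g.
by continuity0; rewrite ?expf_neq0 ?mulf_neq0.
Qed.

Lemma cont0_down z : f_ (a 0) - f_ (z / q) != 0 -> z ^+ 2 - h1 * q ^+ 2 != 0 ->
  cont0 (fun e => coef_down (f_ (a e)) z).
Proof.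
move=> fz z0; have cf := cont0_f; rewrite /coef_down.
by continuity0; rewrite mulf_neq0.
Qed.

Lemma cont0_up z : f_ (a 0) - f_ z != 0 -> z ^+ 2 - h1 != 0 ->
  cont0 (fun e => coef_up (f_ (a e)) z).
Proof.
move=> fz z0; have cf := cont0_f; rewrite /coef_up.
by continuity0; rewrite !mulf_neq0 ?expf_neq0.
Qed.

Lemma cont0_center (k X z : C) :
  b 0 - h2 / b 0 != 0 -> a 0 * b 0 - h1 != 0 ->
  f_ (a 0) - h2 / b 0 - b 0 * h1 / h2 != 0 ->
  f_ (a 0) - f_ (z / q) != 0 -> z ^+ 2 - h1 * q ^+ 2 != 0 ->
  f_ (a 0) - f_ z != 0 -> z ^+ 2 - h1 != 0 ->
  g_ (b 0) != 0 -> g_ (b 0) - g_ (z / q) != 0 -> g_ (b 0) - g_ (h1 / z) != 0 ->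
  cont0 (fun e => coef_center (f_ (a e)) (g_ (b e)) (V_over_phi k X (a e) (b e)) z).
Proof.
move=> bh ab fb fzq zq fz zh gb gzq ghz.
have cf := cont0_f; have cg := cont0_g.
have cd := cont0_down fzq zq; have cu := cont0_up fz zh.
have cV := @cont0_V_over_phi k X bh ab fb.
by rewrite /coef_center; continuity0; rewrite ?mulf_neq0 ?expf_neq0.
Qed.

End Continuity.

End Degeneration.

(** * The limit equation off finitely many z *)

Theorem theorem3p1 (R : realType) (q : R[i]) (u : 'I_8 -> R[i]) (h1 h2 : R[i])
    (rq rU rh1 : R[i]) (Pn Pd : {poly R[i]})
    (q_neq0 : q != 0) (u_neq0 : forall i, u i != 0)
    (h1_neq0 : h1 != 0) (h2_neq0 : h2 != 0)
    (balance : h1 ^+ 2 * h2 ^+ 2 = q * \prod_(i < 8) u i)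
    (h1_neq_h2 : h1 != h2)
    (u1_h1 : u ord0 ^+ 2 != h1)
    (u1_h2 : u ord0 ^+ 2 != h2) (u1_Nh2 : u ord0 ^+ 2 != - h2)
    (rqE : rq ^+ 2 = q) (rUE : rU ^+ 2 = \prod_(i < 8) u i)
    (rqU : rq * rU = h1 * h2) (rh1E : rh1 ^+ 2 = h1)
    (PnE : is_Pn u h2 Pn) (PdE : is_Pd u h2 Pd) :
  exists C0' : R[i], forall c1 c2 : R[i], c1 != c2 ->
    tends_to
      (fun e => gauge q (multiplier q u h1)
                  (L1 q u h1 h2 Pn Pd
                     (f_fun h1 (u ord0 + e * c1)) (g_fun h2 (u ord0 + e * c2))))
      (limit_eq q u h1 rq rU rh1 (C0 q u h1 h2 * (c2 / (c1 - c2)) + C0')).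
Proof.
exists (- \sum_(k < 8) (U'_poly u)`_k * const_part q (u ord0) (h2 / u ord0) h1 k).
move=> c1 c2 c12.
set u1 := u ord0 in u1_h1 u1_h2 u1_Nh2 *.
have u1_neq0 : u1 != 0 by exact: u_neq0.
have {}c12 : c1 - c2 != 0 by rewrite subr_eq0.
have {}u1_h1 : u1 ^+ 2 - h1 != 0 by rewrite subr_eq0.
have {}u1_h2 : u1 ^+ 2 - h2 != 0 by rewrite subr_eq0.
have {}u1_Nh2 : u1 ^+ 2 + h2 != 0 by rewrite addr_eq0.
have h12 : h2 - h1 != 0 by rewrite subr_eq0 eq_sym.
pose D : {poly R[i]} := 'X^2 * ('X^2 - (q * h1)%:P).
pose k := c2 / (c1 - c2).
(* Besides 0: zeros of f - f(z/q), of f - f(z), the remaining zeros of g - g(z/q) and g - g(h1/z),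
   then those of z^2 - q^2 h1, z^2 - h1 and z^2 - q h1. *)
pose S := [:: 0; q * u1; q * h1 / u1; u1; h1 / u1; q * h2 / u1; u1 * h1 / h2;
  q * rh1; - (q * rh1); rh1; - rh1; rq * rh1; - (rq * rh1)].
apply: (@tends_to_cont0 _ _ _ (- q / (u1 * h1))%:P D S) => [||z zS].
- by rewrite polyC_eq0 !mulf_neq0 ?oppr_eq0 ?invr_neq0 ?mulf_neq0.
- rewrite mulf_neq0 ?expf_neq0 ?polyX_eq0 // -size_poly_eq0.
  by rewrite size_XnsubC.
have {zS} : all (fun c => z - c != 0) S.
  by apply/allP => c cS; rewrite subr_eq0; apply: contraNneq zS => ->.
have [x ->] : exists x, z = q * x by exists (z / q); field.
rewrite /S /= subr0 !opprK => /and5P[z0 z1 z2 z3 /and5P[z4 z5 z6 z7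
  /and5P[z8 z9 z10 z11 /andP[z12 _]]]].
have {z0} x0 : x != 0 by apply: contraNneq z0 => ->; rewrite mulr0.
have q20 : q ^+ 2 != 0 by rewrite expf_neq0.
have xqh : q * x ^+ 2 - h1 != 0.
  apply: (neq0_eq (mulf_neq0 (mulf_neq0 z11 z12) (invr_neq0 q_neq0))).
  rewrite -subr_sqr exprMn exprMn rqE rh1E.
  by field.
have xh1 : x ^+ 2 - h1 != 0.
  apply: (neq0_eq (mulf_neq0 (mulf_neq0 z7 z8) (invr_neq0 q20))).
  by rewrite -subr_sqr exprMn exprMn rh1E; field.
have zh1 : (q * x) ^+ 2 - h1 != 0.
  by apply: (neq0_eq (mulf_neq0 z9 z10)); rewrite -subr_sqr rh1E.
have u1x : u1 - x != 0.
  by apply: (neq0_opp (mulf_neq0 z1 (invr_neq0 q_neq0))); field.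
have u1xh1 : u1 * x - h1 != 0.
  apply: (neq0_eq (mulf_neq0 z2 (mulf_neq0 u1_neq0 (invr_neq0 q_neq0)))).
  by field; rewrite q_neq0.
have u1xh2 : u1 * x - h2 != 0.
  apply: (neq0_eq (mulf_neq0 z5 (mulf_neq0 u1_neq0 (invr_neq0 q_neq0)))).
  by field; rewrite q_neq0.
have u1z : u1 - q * x != 0 by apply: (neq0_opp z3); ring.
have u1zh1 : u1 * (q * x) - h1 != 0.
  by apply: (neq0_eq (mulf_neq0 z4 u1_neq0)); field.
have u1h1z : u1 * h1 - h2 * (q * x) != 0.
  by apply: (neq0_opp (mulf_neq0 z6 h2_neq0)); field.
have ND : (- q / (u1 * h1))%:P.[q * x] / D.[q * x]
    = - q / (u1 * h1) / ((q * x) ^+ 2 * ((q * x) ^+ 2 - q * h1)).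
  by rewrite /D !hornerE.
rewrite {}ND.
pose a e := u1 + e * c1; pose b e := u1 + e * c2.
have a0E : a 0 = u1 by rewrite /a mul0r addr0.
have b0E : b 0 = u1 by rewrite /b mul0r addr0.
have ca : cont0 a by rewrite /a; continuity0.
have cb : cont0 b by rewrite /b; continuity0.
have a0 : a 0 != 0 by rewrite a0E.
have b0 : b 0 != 0 by rewrite b0E.
have bh : b 0 - h2 / b 0 != 0.
  rewrite b0E; apply: (neq0_eq (mulf_neq0 u1_h2 (invr_neq0 u1_neq0))).
  by field.
have ab : a 0 * b 0 - h1 != 0 by rewrite a0E b0E -expr2.
(* At a = b = u_1 the second factor of phi is (h2 - h1)(u_1^2 - h2)/(h2 u_1). *)
have fb : f_fun h1 (a 0) - h2 / b 0 - b 0 * h1 / h2 != 0.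
  rewrite a0E b0E /f_fun; apply: (neq0_eq (mulf_neq0 (mulf_neq0 h12 u1_h2)
    (invr_neq0 (mulf_neq0 h2_neq0 u1_neq0)))).
  by field; rewrite u1_neq0.
have qx0 : q * x != 0 by rewrite mulf_neq0.
have zq : q * x / q = x by field.
have fzq : f_fun h1 (a 0) - f_fun h1 (q * x / q) != 0.
  by rewrite a0E zq f_sub // !mulf_neq0 ?invr_neq0 ?mulf_neq0.
have fz : f_fun h1 (a 0) - f_fun h1 (q * x) != 0.
  by rewrite a0E f_sub // !mulf_neq0 ?invr_neq0 ?mulf_neq0.
have gb : g_fun h2 (b 0) != 0.
  rewrite b0E; apply: (neq0_eq (mulf_neq0 u1_Nh2 (invr_neq0 u1_neq0))).
  by rewrite /g_fun; field.
have gzq : g_fun h2 (b 0) - g_fun h2 (q * x / q) != 0.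
  by rewrite b0E zq g_sub // !mulf_neq0 ?invr_neq0 ?mulf_neq0.
have ghz : g_fun h2 (b 0) - g_fun h2 (h1 / (q * x)) != 0.
  have hz0 : h1 / (q * x) != 0 by rewrite mulf_neq0 ?invr_neq0.
  rewrite b0E g_sub //; apply: (neq0_eq (mulf_neq0
    (mulf_neq0 u1zh1 u1h1z) (invr_neq0 (mulf_neq0 (mulf_neq0 u1_neq0 h1_neq0) qx0)))).
  by field; rewrite x0 q_neq0 h1_neq0 u1_neq0.
have zqh : (q * x) ^+ 2 - h1 * q ^+ 2 != 0.
  by apply: (neq0_eq (mulf_neq0 q20 xh1)); ring.
set M := - q / (u1 * h1) / _.
have cM (f : R[i] -> R[i]) m : cont0 f -> cont0 (fun e => M * (f e * m)).
  by move=> cf; continuity0.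
(* The conditions under which V/phi equals its regular form hold near 0, off 0. *)
have near_ab : \forall e \near (0 : R[i]^o)^',
    [/\ e != 0, a e != 0, b e != 0, b e - h2 / b e != 0 & a e * b e - h1 != 0].
  have cbh : cont0 (fun e => b e - h2 / b e) by continuity0.
  have cab : cont0 (fun e => a e * b e - h1) by continuity0.
  near=> e; split; near: e.
  - exact: (@nbhs_dnbhs_neq (R[i]^o : topologicalType) 0).
  - exact: cont0_neq0 ca a0.
  - exact: cont0_neq0 cb b0.
  - exact: cont0_neq0 cbh bh.
  - exact: cont0_neq0 cab ab.
(* The three coefficients, with V/phi replaced by [V_over_phi]. *)
exists (fun e => M * (coef_down q u h1 (f_fun h1 (a e)) (q * x)
  * multiplier q u h1 (q * x / q))).
exists (fun e => M * (coef_up u h1 (f_fun h1 (a e)) (q * x)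
  * multiplier q u h1 (q * (q * x)))).
exists (fun e => M * (coef_center q u h1 h2 (f_fun h1 (a e)) (g_fun h2 (b e))
  (V_over_phi q u h1 h2 k (fbar_fun q h1 (q * x / q)) (a e) (b e)) (q * x)
  * multiplier q u h1 (q * x))).
split.
- have cd := cont0_down (u := u) ca a0 fzq zqh.
  have cu := cont0_up (u := u) h1_neq0 ca a0 fz zh1.
  have cc := cont0_center (u := u) q_neq0 h1_neq0 h2_neq0 ca cb a0 b0
    (k := k) (X := fbar_fun q h1 (q * x / q)) bh ab fb fzq zqh fz zh1 gb gzq ghz.
  by split; [exact: cM cd | exact: cM cu | exact: cM cc].
- apply: filterS near_ab => e [e0 ae be bhe abe].
  rewrite /gauge !L1E (V_over_phiE q_neq0) //.
  by split; rewrite !mulr0 ?add0r ?addr0 mulr1.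
- rewrite a0E b0E /limit_eq; split.
  + by rewrite down_limit // !mulr0 subr0 !addr0 mulr1.
  + by rewrite up_limit // !mulr0 subr0 addr0 add0r mulr1.
  + rewrite (center_limit q_neq0 h1_neq0 h2_neq0 u1_neq0 u1_h1 u1_h2 u1_Nh2 h12 x0
      xqh xh1 zh1 u1x u1xh1 u1xh2 u1z u1zh1 u1h1z _ u_neq0 balance rqE rqU rh1E).
    by rewrite !mulr0 !add0r !mulr1.
Unshelve. all: by end_near.
Qed.
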